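(* Let $X_1,X_2,\ldots$ be independent random variables, each uniformly distributed on $\{1,2,\ldots,6\}$, let $S_n=X_1+\cdots+X_n$ for $n\ge 1$, and let $\tau=\min\{n\ge 1: S_n \text{ is a prime number}\}$. For $k\ge 1$ put $p(k)=P(\tau\ge k)$, and for $K\ge 1$ put $E_K=\sum_{k=1}^{K}p(k)$, $E^{(2)}_K=\sum_{k=1}^{K}(2k-1)p(k)$, $V_K=E^{(2)}_K-(E_K)^2$, $RE_K=E(\tau)-E_K$ and $RV_K=\mathrm{Var}(\tau)-V_K$. Then (a) $RE_{1000}<10^{-7}$, and (b) $RV_{1000}<10^{-4}$.
   Context: $\tau$ is the number of rolls of a fair six-sided die until the total sum of all rolls is first a prime number (with $\tau=\infty$ if this never happens). $E(\tau)$ and $\mathrm{Var}(\tau)=E(\tau^2)-[E(\tau)]^2$ denote its expectation and variance. *)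

(* Defs.v *)
From HB Require Import structures.
From mathcomp Require Import all_boot all_order all_algebra.
From mathcomp Require Import all_classical all_reals all_analysis.

Set Implicit Arguments.
Unset Strict Implicit.
Unset Printing Implicit Defensive.

Import Order.TTheory GRing.Theory Num.Theory.

Local Open Scope classical_set_scope.
Local Open Scope ring_scope.
Local Open Scope ereal_scope.

(* Mutual independence: the product rule over every finite set of indices,
   listed without repetition by s. *)
Definition mutually_independent (d d' : measure_display) (T : measurableType d)
    (T' : measurableType d') (R : realType) (P : probability T R)
    (X : nat -> {RV P >-> T'}) : Prop :=
  forall (s : seq nat) (B : nat -> set T'),
    uniq s -> (forall i, measurable (B i)) ->
    P (\bigcap_(i in [set` s]) (X i @^-1` B i)) =
    \prod_(i <- s) P (X i @^-1` B i).

(* These six atoms have total mass 1, so they determine the law of X. *)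
Definition uniform_die (d : measure_display) (T : measurableType d)
    (R : realType) (P : probability T R) (X : {RV P >-> nat}) : Prop :=
  forall k : nat, (1 <= k <= 6)%N -> distribution P X [set k] = (6^-1)%:E.

Section prime_stopping.
Context (d : measure_display) (T : measurableType d) (R : realType)
  (P : probability T R).

(* Rolls are numbered from 0: X i is the (i + 1)-st roll, so roll_sum X n is
   the sum of the first n rolls. *)
Definition roll_sum (X : nat -> {RV P >-> nat}) (n : nat) (w : T) : nat :=
  (\sum_(i < n) X i w)%N.

Definition prime_at (X : nat -> {RV P >-> nat}) (w : T) : pred nat :=
  fun n => (1 <= n)%N && prime (roll_sum X n w).

Definition tau (X : nat -> {RV P >-> nat}) (w : T) : \bar R :=
  if pselect (exists n, prime_at X w n) is left ex
  then (ex_minn ex)%:R%:E else +oo.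

(* The library's 'E_P and 'V_P are for real-valued functions only; these are
   their analogues for functions that may take the value +oo. *)
Definition eexpectation (Y : T -> \bar R) : \bar R := \int[P]_w Y w.

Definition evariance (Y : T -> \bar R) : \bar R :=
  eexpectation (fun w => Y w ^+ 2) - eexpectation Y ^+ 2.

Definition tail_prob (X : nat -> {RV P >-> nat}) (k : nat) : \bar R :=
  P [set w | k%:R%:E <= tau X w].

Definition E_trunc (X : nat -> {RV P >-> nat}) (K : nat) : \bar R :=
  \sum_(1 <= k < K.+1) tail_prob X k.

Definition E2_trunc (X : nat -> {RV P >-> nat}) (K : nat) : \bar R :=
  \sum_(1 <= k < K.+1) (2 * k - 1)%N%:R%:E * tail_prob X k.

Definition V_trunc (X : nat -> {RV P >-> nat}) (K : nat) : \bar R :=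
  E2_trunc X K - E_trunc X K ^+ 2.

Definition RE (X : nat -> {RV P >-> nat}) (K : nat) : \bar R :=
  eexpectation (tau X) - E_trunc X K.

(* Since +oo - +oo = -oo in \bar R, a bound RV X K < r has its intended meaning
   only once eexpectation (tau X) is known to be finite, which any real upper
   bound on RE X K implies. *)
Definition RV (X : nat -> {RV P >-> nat}) (K : nat) : \bar R :=
  evariance (tau X) - V_trunc X K.

End prime_stopping.

(* Main.v *)
Require Import Defs.
From Stdlib Require Import BinNat Nnat.
From HB Require Import structures.
From mathcomp Require Import all_boot all_order all_algebra.
From mathcomp Require Import all_classical all_reals all_analysis.
From mathcomp Require Import measurable_realfun.
From mathcomp Require Import zify ring lra.

(* Let u(s) be the expected number of visits to s of the walk killed at the first
   prime; u vanishes at primes and elsewhere u(s) is the mean of u(s-1), ..., u(s-6).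
   Since S_k >= k, both tail sums of P(tau > k) over k >= 1000 (with weights 1 and
   2k+1) are at most the sum of (2s+1) u(s) over s >= 1000.  A bound c for u beyond
   n stays valid, and improves to 5c/6 beyond any prime p >= n+5, because each of
   the six means after p contains u(p) = 0; hence u(s) <= (5/6)^(pi(s)/6), which with
   Chebyshev's lower bound for pi(2^j), read off the central binomial coefficient,
   gives u(s) <= s^-5 for s > 2^15.  For 1000 <= s <= 2^15 it suffices that u is
   below 10^-24 at six consecutive points, which exact integer arithmetic shows.
   For the variance, the replacement of E(tau)^2 by its truncation only helps. *)

Set Implicit Arguments.
Unset Strict Implicit.
Unset Printing Implicit Defensive.

Import Order.TTheory GRing.Theory Num.Theory.

Local Open Scope classical_set_scope.
Local Open Scope ring_scope.

(** * Chebyshev's lower bound *)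

Definition primepi (n : nat) : nat := count prime (iota 0 n).

Lemma primepiS n : primepi n.+1 = (primepi n + prime n)%N.
Proof. by rewrite /primepi -addn1 iotaD count_cat /= addn0. Qed.

Lemma primepiD n m : (primepi (n + m) <= primepi n + m)%N.
Proof.
rewrite /primepi iotaD count_cat leq_add2l.
by rewrite (leq_trans (count_size _ _)) ?size_iota.
Qed.

Lemma leq_primepi n m : (n <= m)%N -> (primepi n <= primepi m)%N.
Proof. by move=> /subnKC <-; rewrite /primepi iotaD count_cat leq_addr. Qed.

(** By Legendre's formula the exponent is the sum over [i] of [n %/ p ^ i - m %/ p ^ i - (n - m) %/
    p ^ i]. Each term is at most 1 and vanishes once [p ^ i > n]. *)
Lemma prime_power_dvd_bin p n m : prime p -> (0 < n)%N -> (m <= n)%N ->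
  (p ^ logn p 'C(n, m) <= n)%N.
Proof.
move=> pp n0 mn; have p1 := prime_gt1 pp.
suff: (logn p 'C(n, m) <= trunc_log p n)%N.
  by move=> h; apply: leq_trans (trunc_logP p1 n0); rewrite leq_exp2l.
(* A common range up to [n] lets the three factorials be compared term by term; the added terms are
   zero because [k < i < p ^ i]. *)
have fact_widen k : (k <= n)%N ->
    logn p k`! = (\sum_(1 <= i < n.+1) k %/ p ^ i)%N.
  move=> kn; rewrite logn_fact // [RHS](@big_cat_nat _ _ _ k.+1) //=.
  rewrite [X in (_ + X)%N]big1_seq ?addn0 // => i /andP[_].
  rewrite mem_index_iota => /andP[ki _]; rewrite divn_small //.
  by rewrite (ltn_trans ki) // ltn_expl.
have sum_trunc t l : (\sum_(1 <= k < l.+1) (k <= t) <= t)%N.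
  suff -> : (\sum_(1 <= k < l.+1) (k <= t) = minn l t)%N by lia.
  by elim: l => [|l IH]; [rewrite big_geq; lia | rewrite big_nat_recr //= IH; lia].
apply: leq_trans (sum_trunc _ n).
have := congr1 (logn p) (bin_fact mn).
rewrite !lognM ?muln_gt0 ?fact_gt0 ?bin_gt0 // !fact_widen ?leq_subr //.
rewrite -big_split /= => e.
suff: (\sum_(1 <= i < n.+1) n %/ p ^ i <=
    \sum_(1 <= i < n.+1) (i <= trunc_log p n) +
    \sum_(1 <= i < n.+1) (m %/ p ^ i + (n - m) %/ p ^ i))%N by lia.
rewrite -big_split /= leq_sum // => i _.
have [pin|npi] := leqP (p ^ i) n; last by rewrite divn_small.
rewrite (trunc_log_max p1 pin) -{1}(subnKC mn) divnD ?expn_gt0 ?prime_gt0 //.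
by rewrite addnC leq_add2r leq_b1.
Qed.

(** Every prime power in the factorization is at most [n]; in particular so is every prime that
    occurs. *)
Lemma bin_le_primepi n m : (m <= n)%N -> ('C(n, m) <= n ^ primepi n.+1)%N.
Proof.
case: n => [|n] mn; first by move: mn; rewrite leqn0 => /eqP ->.
have C0 : (0 < 'C(n.+1, m))%N by rewrite bin_gt0.
have -> : 'C(n.+1, m) = (\prod_(p <- primes 'C(n.+1, m)) p ^ logn p 'C(n.+1, m))%N.
  by rewrite {1}(prod_prime_decomp C0) prime_decompE big_map.
have /leq_trans : (\prod_(p <- primes 'C(n.+1, m)) p ^ logn p 'C(n.+1, m) <=
    \prod_(p <- primes 'C(n.+1, m)) n.+1)%N.
  rewrite !big_seq leq_prod // => p; rewrite mem_primes => /and3P[pp _ _].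
  exact: prime_power_dvd_bin.
apply; rewrite big_const_seq count_predT iter_muln_1 leq_pexp2l // /primepi -size_filter.
rewrite uniq_leq_size ?primes_uniq // => p pC.
have pp : prime p by move: pC; rewrite mem_primes => /andP[].
rewrite mem_filter pp mem_iota /= add0n ltnS.
apply: leq_trans (prime_power_dvd_bin pp _ mn) => //.
by rewrite -{1}(expn1 p) leq_pexp2l ?logn_gt0 // prime_gt0.
Qed.

(** Induction through [(m + 1) C(2m + 2, m + 1) = 2 (2m + 1) C(2m, m)]. *)
Lemma leq_4exp_bin n : (0 < n)%N -> (4 ^ n <= n.*2 * 'C(n.*2, n))%N.
Proof.
elim: n => [//|[|n] IH _]; first by [].
move/(_ isT): IH; move: n.+1 => m IH.
have h1 := mul_bin_diag m.+1.*2 m.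
have h2 := mul_bin_down m.*2.+1 m.
rewrite !doubleS /= in h1 h2 *.
rewrite (_ : (m.*2.+1 - m = m.+1)%N) in h2; last by lia.
have h3 : ('C(m.*2.+2, m.+1) = 2 * 'C(m.*2.+1, m))%N.
  by apply/eqP; rewrite -(eqn_pmul2l (ltn0Sn m)) -h1 mulnA muln2 doubleS.
rewrite expnS h3.
apply: (@leq_trans (4 * (m.*2.+1 * 'C(m.*2, m)))%N); last by rewrite h2; lia.
rewrite leq_mul2l /= (leq_trans IH) // leq_mul2r leqnSn orbT //.
Qed.

(** With [N = 2 ^ j], the two bounds on the central binomial coefficient give
    [2 ^ N <= N ^ (pi(N) + 1)]; the claim compares exponents of 2. *)
Lemma primepi_exp2 j : (0 < j)%N -> (2 ^ j <= j * (primepi (2 ^ j).+1).+1)%N.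
Proof.
case: j => // j _; set n := (2 ^ j)%N.
have nE : (2 ^ j.+1 = n.*2)%N by rewrite expnS mul2n.
have n0 : (0 < n)%N by rewrite expn_gt0.
rewrite -(@leq_exp2l 2) // mulnS expnD expnM nE.
apply: leq_trans (_ : (4 ^ n <= _)%N); first by rewrite -mul2n expnM.
apply: (leq_trans (leq_4exp_bin n0)); rewrite leq_mul2l bin_le_primepi ?orbT //.
by rewrite -addnn leq_addl.
Qed.

(** The constant is [120 = 6 * 20]: six primes are spent per factor 5/6, and [green_large] needs
    [20 * j.+1] such factors. *)
Lemma primepi_exp2_lower j : (15 <= j)%N -> (120 * j.+1 <= primepi (2 ^ j).+1)%N.
Proof.
move=> j15; have j0 : (0 < j)%N by lia.
have := primepi_exp2 j0.
suff: (120 * j * j.+1 + j <= 2 ^ j)%N by nia.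
move: j15 => /subnKC <-; elim: (j - 15)%N => [|k IH].
  have -> : (2 ^ (15 + 0) = 32 * 1024)%N by []. lia.
by rewrite addnS expnS; nia.
Qed.

(** * The killed walk *)

(* P(S_k = s and none of S_1, ..., S_k is prime). *)
Fixpoint avoid (R : realFieldType) (k s : nat) : R :=
  if k is k'.+1 then
    if prime s then 0
    else \sum_(1 <= j < 7 | (j <= s)%N) avoid R k' (s - j) / 6
  else (s == 0%N)%:R.

(* The expected number of visits to s before the first prime: the Green function
   of the killed walk (avoid R k s = 0 for k > s). *)
Definition green (R : realFieldType) (s : nat) : R :=
  \sum_(0 <= k < s.+1) avoid R k s.

Section Green.
Context (R : realFieldType).
Local Notation q := (avoid R).
Local Notation u := (green R).

Lemma avoid_ge0 k s : 0 <= q k s.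
Proof.
elim: k s => [|k IH] s /=; first by rewrite ler0n.
by case: ifP => // _; rewrite sumr_ge0 // => j _; rewrite divr_ge0.
Qed.

Lemma avoid_eq0 k s : (s < k)%N -> q k s = 0.
Proof.
elim: k s => [//|k IH] s /= sk; case: ifP => // _.
rewrite big_nat_cond big1 // => j /andP[/andP[j0 _] js].
by rewrite IH ?mul0r //; lia.
Qed.

Lemma sum_avoid N s : (s < N)%N -> \sum_(0 <= k < N) q k s = u s.
Proof.
move=> sN; rewrite (@big_cat_nat _ _ _ s.+1) //= [X in _ + X]big_nat_cond.
by rewrite [X in _ + X]big1 ?addr0 // => k /andP[/andP[sk _] _]; rewrite avoid_eq0.
Qed.

Lemma green_ge0 s : 0 <= u s.
Proof. by rewrite sumr_ge0 // => k _; rewrite avoid_ge0. Qed.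

Lemma green0 : u 0 = 1.
Proof. by rewrite /green big_nat1. Qed.

Lemma green_prime p : prime p -> u p = 0.
Proof.
move=> pp; rewrite /green big1 // => -[|k] _ /=; last by rewrite pp.
by case: p pp.
Qed.

Lemma green_rec s : (0 < s)%N -> ~~ prime s ->
  u s = \sum_(1 <= j < 7 | (j <= s)%N) u (s - j) / 6.
Proof.
case: s => // s _ sp; rewrite /green big_nat_recl //= add0r (negbTE sp).
rewrite exchange_big /= big_nat_cond [RHS]big_nat_cond.
apply: eq_bigr => j /andP[/andP[j0 _] js]; rewrite -mulr_suml.
by rewrite sum_avoid //; lia.
Qed.

Lemma green_le1 s : u s <= 1.
Proof.
elim/ltn_ind: s => -[|s] IH; first by rewrite green0.
have [sp|sp] := boolP (prime s.+1); first by rewrite green_prime.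
rewrite green_rec //; apply: (@le_trans _ _ (\sum_(1 <= j < 7) 6^-1)).
  rewrite big_mkcond /= !big_nat ler_sum // => j /andP[j0 _].
  case: ifP => _; last by rewrite invr_ge0.
  by rewrite -[leRHS]mul1r ler_pM2r ?invr_gt0 // IH //; lia.
by rewrite sumr_const_nat -[(7 - 1)%N]/6%N -mulr_natl; lra.
Qed.

Lemma green_window s : (6 <= s)%N -> ~~ prime s ->
  u s = (u (s - 1) + u (s - 2) + u (s - 3) + u (s - 4) + u (s - 5) + u (s - 6)) / 6.
Proof.
move=> s6 sp; rewrite green_rec //; last by lia.
rewrite big_nat_cond (eq_bigl (fun j => 1 <= j < 7)%N); last first.
  by move=> j /=; lia.
by rewrite -big_nat unlock /=; lra.
Qed.

(** A maximum principle: each later value is zero or the mean of the six before it. *)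
Lemma green_bound_extend n c : 0 <= c ->
  (forall s, (n <= s < n + 6)%N -> u s <= c) -> forall s, (n <= s)%N -> u s <= c.
Proof.
move=> c0 H; elim/ltn_ind => s IH ns.
have [sn|sn] := ltnP s (n + 6); first by apply: H; rewrite ns.
have [sp|sp] := boolP (prime s); first by rewrite green_prime.
rewrite green_window //; last by lia.
have h j : (0 < j <= 6)%N -> u (s - j) <= c by move=> ?; apply: IH; lia.
have := h 1%N isT; have := h 2%N isT; have := h 3%N isT.
have := h 4%N isT; have := h 5%N isT; have := h 6%N isT; lra.
Qed.

(** The six points after [p] have windows that start no earlier than [p - 5 >= n] and contain [p],
    where the Green function vanishes. The maximum principle carries the improved bound further. *)
Lemma green_bound_prime n p c : 0 <= c -> prime p -> (n + 5 <= p)%N ->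
  (forall s, (n <= s)%N -> u s <= c) ->
  forall s, (p < s)%N -> u s <= 5 / 6 * c.
Proof.
move=> c0 pp np H; apply: green_bound_extend => [|s ps]; first by lra.
have [sp|sp] := boolP (prime s); first by rewrite green_prime //; lra.
rewrite green_window //; last by lia.
have h j : (0 < j <= 6)%N -> u (s - j) <= c by move=> ?; apply: H; lia.
have : (s - p = 1 \/ s - p = 2 \/ s - p = 3 \/ s - p = 4 \/ s - p = 5 \/
  s - p = 6)%N by lia.
have := h 1%N isT; have := h 2%N isT; have := h 3%N isT.
have := h 4%N isT; have := h 5%N isT; have := h 6%N isT.
have up := green_prime pp.
have sE : (s - (s - p) = p)%N by lia.
by move=> ? ? ? ? ? ? [e|[e|[e|[e|[e|e]]]]]; rewrite e in sE; rewrite sE up; lra.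
Qed.

(** The largest prime below [n] yields one factor 5/6. Stepping back five more integers, as
    [green_bound_prime] requires, loses at most five further primes, hence six per factor. *)
Lemma green_primepi m n s : (6 * m <= primepi n)%N -> (n <= s)%N ->
  u s <= (5 / 6) ^+ m.
Proof.
elim: m n s => [|m IH] n s; first by rewrite green_le1.
elim: n s => [|n IHn] s; first by [].
rewrite primepiS; have [np|np] := boolP (prime n); last first.
  by rewrite addn0 => mn ns; apply: IHn => //; lia.
rewrite addn1 exprS => mn ns.
(* Below 5 there are too few primes for the hypothesis, so the subtraction [n - 5] is not truncated
   in the other case. *)
have [n5|n5] := ltnP n 5.
  have := leq_primepi (ltnW n5); rewrite (_ : primepi 5 = 2)%N //; lia.
have c0 : 0 <= (5 / 6) ^+ m :> R by rewrite exprn_ge0.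
apply: (@green_bound_prime (n - 5) n _ c0 np _ _ s ns) => [|t nt]; first by lia.
apply: IH nt.
by have := primepiD (n - 5) 5; rewrite subnK //; lia.
Qed.

Lemma green_large s : (2 ^ 15 < s)%N -> u s <= s%:R ^- 5.
Proof.
move=> s15; have s0 : (0 < s)%N by lia.
(* The predecessor makes the lower bound strict: [2 ^ j < s <= 2 ^ j.+1]. *)
set j := trunc_log 2 s.-1.
have j15 : (15 <= j)%N by apply: trunc_log_max => //; lia.
have js : (2 ^ j < s)%N.
  by have := @trunc_logP 2 s.-1 isT; rewrite -/j; lia.
have sj : (s <= 2 ^ j.+1)%N.
  by have := @trunc_log_ltn 2 s.-1 isT; rewrite -/j; lia.
apply: (@le_trans _ _ ((5 / 6) ^+ (20 * j.+1))).
  by apply: (@green_primepi _ (2 ^ j).+1) => //; have := primepi_exp2_lower j15; lia.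
apply: (@le_trans _ _ ((2 ^ j.+1)%:R ^- 5)); last first.
  by rewrite lef_pV2 ?posrE ?exprn_gt0 ?ltr0n ?expn_gt0 // lerXn2r ?nnegrE // ler_nat.
(* Exponents are grouped in fours because [(5 / 6) ^ 4 <= 1 / 2]. *)
rewrite natrX -exprM -exprVn (_ : 20 * j.+1 = 4 * (j.+1 * 5))%N; last by lia.
by rewrite exprM lerXn2r ?nnegrE ?exprn_ge0 ?invr_ge0 //; lra.
Qed.

End Green.

(** * Exact integer evaluation of the Green function *)

(* scaled_green s lists the integers 6 ^ i * green R i for i = s, ..., 0; in this
   scaling the recursion of green has the integer coefficients 6 ^ (j - 1). *)
Definition scaled_step (h : seq N) : N :=
  let v i := nth 0%num h i in
  (v 0 + 6 * (v 1 + 6 * (v 2 + 6 * (v 3 + 6 * (v 4 + 6 * v 5)))))%num.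

Fixpoint scaled_green (s : nat) : seq N :=
  if s is s'.+1 then
    let h := scaled_green s' in
    (if prime s then 0%num else scaled_step h) :: h
  else [:: 1%num].

(** Entry [i] times [6 ^ i] is [6 ^ n * green R (n - i)], so the test certifies the bound [10 ^- e]
    at the six points [n - 5], ..., [n]. *)
Definition scaled_green_check (n e : nat) : bool :=
  let h := scaled_green n in
  all (fun i => N.leb
      (10 ^ N.of_nat e * (6 ^ N.of_nat i * nth 0%num h i)) (6 ^ N.of_nat n))%num
    (iota 0 6).

(** The exponent 24 suffices because [10 ^- 24 <= (2 ^ 15) ^- 5]. *)
Lemma scaled_green_check1000 : scaled_green_check 1000 24.
Proof. by vm_compute. Qed.

Section ScaledGreen.
Context (R : realFieldType).
Local Notation u := (green R).
Local Notation valN x := ((N.to_nat x)%:R : R).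

Lemma natr_addN x y : valN (x + y)%num = valN x + valN y.
Proof. by rewrite N2Nat.inj_add plusE natrD. Qed.

Lemma natr_mulN x y : valN (x * y)%num = valN x * valN y.
Proof. by rewrite N2Nat.inj_mul multE natrM. Qed.

Lemma natr_powN x (n : nat) : valN (x ^ N.of_nat n)%num = valN x ^+ n.
Proof.
elim: n => [|n IH]; first by [].
by rewrite Nat2N.inj_succ N.pow_succ_r' natr_mulN IH exprS.
Qed.

Lemma ler_natN x y : N.leb x y -> valN x <= valN y.
Proof.
move/N.leb_le => xy; rewrite -(N.sub_add _ _ xy) natr_addN lerDr; exact: ler0n.
Qed.

Lemma scaled_greenE (s i : nat) :
  valN (nth 0%num (scaled_green s) i) =
  if (i <= s)%N then 6 ^+ (s - i) * u (s - i) else 0.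
Proof.
elim: s i => [|s IH] [|i]; rewrite [scaled_green _]/=.
- by rewrite green0 mulr1.
- by rewrite /= nth_nil.
- rewrite [nth _ _ _]/=; case: ifP => sp; first by rewrite green_prime // mulr0.
  have v6 : valN 6 = 6 by [].
  rewrite /scaled_step !(natr_addN, natr_mulN) !IH v6.
  rewrite [(s.+1 - 0)%N]subn0 (@green_rec _ s.+1) ?sp // big_mkcond unlock /=
     ?ltnS ?subSS ?subn0 ?leq0n {IH sp}.
  (* At the points 1 to 5 the window of six predecessors is cut off at 0, so each is treated
     separately. *)
  do 5 (case: s => [|s];
    first by rewrite ?subSS ?subn0 !exprS ?expr0 [LHS]/= [RHS]/=; lra).
  rewrite !subSS ?subn0 !exprS [LHS]/= [RHS]/=; lra.
- by rewrite [nth _ _ _]/= IH ltnS subSS.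
Qed.

Lemma green_scaled_check n e s : scaled_green_check n e ->
  (5 <= n)%N -> (n <= s + 5)%N -> u s <= 10 ^- e.
Proof.
move=> /allP H n5 ns.
apply: (@green_bound_extend _ (n - 5)); last by lia.
  by rewrite invr_ge0 exprn_ge0.
move=> {ns}s /andP[s1 s2].
have /H : (n - s)%N \in iota 0 6 by rewrite mem_iota; lia.
move=> /ler_natN; rewrite !(natr_mulN, natr_powN) scaled_greenE.
rewrite leq_subr (_ : (n - (n - s) = s)%N); last by lia.
have -> : valN 6 = 6 by [].
have -> : valN 10 = 10 by [].
rewrite [X in _ * X <= _]mulrA -exprD subnK; last by lia.
rewrite mulrCA ger_pMr ?exprn_gt0 // => h.
by rewrite -div1r ler_pdivlMr ?exprn_gt0 // mulrC.
Qed.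

Lemma green_decay s : (1000 <= s)%N -> u s <= s%:R ^- 5.
Proof.
move=> s1000; have [s15|/green_large //] := leqP s (2 ^ 15)%N.
apply: le_trans (green_scaled_check scaled_green_check1000 _ _) _ => //.
  exact: leq_trans s1000 (leq_addr _ _).
have s0 : (0 < s)%N by exact: leq_trans s1000.
rewrite lef_pV2 ?posrE ?exprn_gt0 ?ltr0n //.
apply: (@le_trans _ _ ((2 ^+ 15) ^+ 5)); last by rewrite -exprM; lra.
rewrite lerXn2r ?nnegrE ?exprn_ge0 ?ler0n //. by rewrite -natrX ler_nat.
Qed.

End ScaledGreen.

(** * Summation of the tail of the Green function *)

Section TailSum.
Context (R : realFieldType).
Local Notation u := (green R).
Local Notation q := (avoid R).

Lemma natr_doubleS n : (n.*2.+1)%:R = 2 * n%:R + 1 :> R.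
Proof. by rewrite -addn1 -muln2 natrD natrM mulrC. Qed.

Lemma sum_green_tail M :
  \sum_(1000 <= s < M) (s.*2.+1)%:R * u s <= 4 * 10 ^- 9.
Proof.
have [M1000|M1000] := leqP M 1000.
  by rewrite big_geq // mulr_ge0 // invr_ge0 exprn_ge0.
(* A telescoping majorant: for [x >= 1000], [(2x + 1) / x ^ 5] is at most
   [3 * 10 ^- 6 / (x (x - 1))]. *)
suff: \sum_(1000 <= s < M) (s.*2.+1)%:R * u s <=
    3 * 10 ^- 6 * (999^-1 - (M%:R - 1)^-1).
  have : 0 <= (M%:R - 1)^-1 :> R by rewrite invr_ge0 subr_ge0 ler1n (leq_trans _ M1000).
  lra.
elim: M M1000 => [//|M IH]; rewrite ltnS leq_eqVlt => /predU1P[<-|M1000].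
  rewrite big_nat1; have := green_decay R (leqnn 1000).
  move: (u 1000) => x; rewrite natr_doubleS -[1001%:R]natr1 addrK; lra.
rewrite big_nat_recr ?(ltnW M1000) //=.
have := IH M1000; set S := (X in X <= _).
have := green_decay R (ltnW M1000); set x : R := M%:R => ux HS.
have x1000 : 1000 <= x by rewrite ler_nat ltnW.
have -> : M.+1%:R - 1 = x by rewrite -natr1 addrK.
rewrite natr_doubleS -/x.
have x0 : 0 < x by lra.
suff h : (2 * x + 1) * x ^- 5 <= 3 * 10 ^- 6 * ((x - 1)^-1 - x^-1).
  have : (2 * x + 1) * u M <= (2 * x + 1) * x ^- 5 by rewrite ler_pM2l //; lra.
  rewrite -/S; lra.
have -> : 3 * 10 ^- 6 * ((x - 1)^-1 - x^-1) = (3 * x ^+ 4 / (10 ^+ 6 * (x - 1))) * x ^- 5.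
  by field; rewrite ?gt_eqF //; lra.
rewrite ler_pM2r ?invr_gt0 ?exprn_gt0 // ler_pdivlMr; last by lra.
have h1 : 10 ^+ 6 <= x ^+ 2 by nra.
have h2 : (2 * x + 1) * (x - 1) <= 3 * x ^+ 2 by nra.
have -> : (2 * x + 1) * (10 ^+ 6 * (x - 1)) = 10 ^+ 6 * ((2 * x + 1) * (x - 1)) by ring.
have -> : 3 * x ^+ 4 = x ^+ 2 * (3 * x ^+ 2) by ring.
by apply: ler_pM => //; nra.
Qed.

(** After exchanging the sums, only [k <= s] contributes, so the weight may be raised to that of
    [s]; summing over [k] then gives [green R s]. *)
Lemma sum_avoid_tail N M :
  \sum_(1000 <= k < N) (k.*2.+1)%:R * (\sum_(0 <= s < M) q k s) <= 4 * 10 ^- 9.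
Proof.
apply: (le_trans _ (sum_green_tail M)).
under eq_bigr do rewrite mulr_sumr.
rewrite exchange_big /=.
have [M1000|M1000] := leqP M 1000.
  rewrite [leRHS]big_geq // big_nat big1 // => s /andP[_ sM].
  rewrite big_nat big1 // => k /andP[k1 _].
  by rewrite avoid_eq0 ?mulr0 //; lia.
rewrite (@big_cat_nat _ _ _ 1000) ?(ltnW M1000) //= big_nat big1 ?add0r; last first.
  move=> s /andP[_ sM]; rewrite big_nat big1 // => k /andP[k1 _].
  by rewrite avoid_eq0 ?mulr0 //; lia.
apply: ler_sum => s _.
(* The upper limit covers both the given range of [k] and all nonzero terms of [green R s]. *)
apply: (@le_trans _ _ (\sum_(0 <= k < maxn N s.+1) (s.*2.+1)%:R * q k s)); last first.
  by rewrite -mulr_sumr sum_avoid // leq_maxr.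
have [N1000|N1000] := leqP N 1000.
  by rewrite big_geq // sumr_ge0 // => k _; rewrite mulr_ge0 ?avoid_ge0.
rewrite [leRHS](@big_cat_nat _ _ _ 1000) /=; [|lia..].
rewrite [X in _ <= _ + X](@big_cat_nat _ _ _ N) /=; [|lia..].
set A := \sum_(_ <= _ < 1000) _; set B := \sum_(N <= _ < _) _.
have A0 : 0 <= A by rewrite sumr_ge0 // => k _; rewrite mulr_ge0 ?avoid_ge0.
have B0 : 0 <= B by rewrite sumr_ge0 // => k _; rewrite mulr_ge0 ?avoid_ge0.
suff : \sum_(1000 <= k < N) (k.*2.+1)%:R * q k s <=
  \sum_(1000 <= k < N) (s.*2.+1)%:R * q k s by lra.
apply: ler_sum => k _; have [ks|sk] := leqP k s; last by rewrite avoid_eq0 // !mulr0.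
by rewrite ler_wpM2r ?avoid_ge0 // ler_nat ltnS leq_double.
Qed.
End TailSum.

(** * Tail probabilities *)

Local Open Scope ereal_scope.

(** The null set [B] is there to absorb the outcomes in which some roll is not a face of the die. *)
Lemma measure_le_cover (d : measure_display) (T : measurableType d) (R : realType)
    (mu : measure T R) (n : nat) (A B : set T) (F : nat -> set T) :
  measurable A -> measurable B -> (forall i, measurable (F i)) ->
  mu B = 0 -> (forall w, A w -> B w \/ exists2 i, (i < n)%N & F i w) ->
  mu A <= \sum_(i < n) mu (F i).
Proof.
move=> mA mB mF B0 AF.
have mU : measurable (\big[setU/set0]_(i < n) F i).
  by apply: bigsetU_measurable.
have : mu A <= mu (\big[setU/set0]_(i < n) F i `|` B).
  apply: le_measure; rewrite ?inE //; first exact: measurableU.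
  by move=> w /AF[Bw|[i ni Fi]]; [right|left; rewrite -bigcup_mkord; exists i].
rewrite (measureU0 mU mB B0) => /le_trans; apply.
exact: (Boole_inequality mu (fun i _ => mF i)).
Qed.

(** * Pointwise layer-cake formulas *)

Section LayerCake.
Context (R : realType) (a : nat -> nat) (a0 : forall k, (0 < a k)%N).

(** All indicators equal 1 and each [a k] is at least 1, so the partial sums are unbounded. *)
Lemma layer_cake_pinfty :
  \sum_(0 <= k <oo) (a k)%:R%:E * (k.+1%:R%:E <= +oo :> \bar R)%E%:R%:E = +oo :> \bar R.
Proof.
apply: eq_infty => A.
apply: (@le_trans _ _ (Num.truncn A).+1%:R%:E).
  by rewrite lee_fin ltW // truncnS_gt.
apply: le_trans (nneseries_lim_ge (Num.truncn A).+1 _) => [|k _ _]; last first.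
  by rewrite mule_ge0 // lee_fin.
under eq_bigr do rewrite leey mule1.
rewrite sumEFin lee_fin -natr_sum ler_nat.
elim: (Num.truncn A).+1 => [//|n IH].
by rewrite big_nat_recr //= -addn1 leq_add.
Qed.

Lemma layer_cake_nat n :
  \sum_(0 <= k <oo) (a k)%:R%:E * (k.+1%:R%:E <= n%:R%:E :> \bar R)%E%:R%:E =
  (\sum_(0 <= k < n) a k)%N%:R%:E :> \bar R.
Proof.
rewrite (nneseries_split 0 n) => [|k _]; last by rewrite mule_ge0 // lee_fin.
rewrite add0n eseries0 ?adde0 => [|k nk _]; last first.
  by rewrite lee_fin ler_nat ltnNge nk mule0.
rewrite natr_sum -sumEFin !big_nat; apply: eq_bigr => k /andP[_ kn].
by rewrite lee_fin ler_nat kn mule1.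
Qed.

End LayerCake.

(** * Moments of the stopping time as series of tail probabilities *)

Section DieRolls.
Context (d : measure_display) (T : measurableType d) (R : realType)
  (P : probability T R) (X : nat -> {RV P >-> nat}).

Definition unhit (k : nat) : set T :=
  [set w | forall n, (n <= k)%N -> ~~ prime_at X w n].

Lemma le_tau k w : (k.+1%:R%:E <= tau X w) = `[< unhit k w >].
Proof.
apply/idP/asboolP; rewrite /tau; case: pselect => [ex|nex].
- case: ex_minnP => m mp mmin; rewrite lee_fin ler_nat => km n nk.
  by apply/negP => /mmin; lia.
- by move=> _ n _; apply/negP => np; apply: nex; exists n.
- case: ex_minnP => m mp mmin uw; rewrite lee_fin ler_nat ltnNge.
  by apply/negP => /uw; rewrite mp.
- by rewrite leey.
Qed.

Lemma tau_natP w : tau X w = +oo \/ exists n, tau X w = n%:R%:E.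
Proof. by rewrite /tau; case: pselect => [ex|]; [right; eexists|left]. Qed.

Lemma tail_probE k : tail_prob X k.+1 = P (unhit k).
Proof.
by congr (P _); apply/seteqP; split => w /=; rewrite le_tau => /asboolP.
Qed.

Lemma roll_sum0 w : roll_sum X 0 w = 0%N.
Proof. by rewrite /roll_sum big_ord0. Qed.

Lemma roll_sumS n w : roll_sum X n.+1 w = (roll_sum X n w + X n w)%N.
Proof. by rewrite /roll_sum big_ord_recr. Qed.

Lemma unhitS k w :
  unhit k.+1 w <-> unhit k w /\ ~~ prime (roll_sum X k.+1 w).
Proof.
split=> [h|[h1 h2] n].
  by split; [move=> n nk; apply: h; lia | have := h k.+1 (leqnn _)].
by rewrite leq_eqVlt => /predU1P[->|/h1].
Qed.

Lemma measurable_roll_sum n : measurable_fun setT (roll_sum X n).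
Proof.
elim: n => [|n IH].
  by apply: (eq_measurable_fun (cst 0%N)) => // w _; rewrite roll_sum0.
apply: (eq_measurable_fun (fun w => roll_sum X n w + X n w)%N).
  by move=> w _; rewrite roll_sumS.
exact: measurable_fun_addn.
Qed.

Lemma measurable_roll_sum_set n (B : set nat) : measurable [set w | B (roll_sum X n w)].
Proof. by rewrite -[X in measurable X]setTI; apply: measurable_roll_sum. Qed.

Lemma measurable_roll_set n (B : set nat) : measurable [set w | B (X n w)].
Proof. by rewrite -[X in measurable X]setTI; apply: measurable_funP. Qed.

Lemma measurable_unhit k : measurable (unhit k).
Proof.
rewrite (_ : unhit k = \bigcap_(n in [set n | (n <= k)%N])
    [set w | [set s | ~~ ((0 < n)%N && prime s)] (roll_sum X n w)]).
  by apply: bigcap_measurableType => n _; apply: measurable_roll_sum_set.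
by apply/seteqP; split.
Qed.
#[local] Hint Resolve measurable_unhit measurable_roll_sum_set measurable_roll_set : core.

Section Tau.
Context (a : nat -> nat) (a0 : forall k, (0 < a k)%N) (f : \bar R -> \bar R).
Context (f_pinfty : f +oo = +oo)
  (f_nat : forall n, f n%:R%:E = (\sum_(0 <= k < n) a k)%N%:R%:E).

(** Here [a] lists the increments of [f], so [f (tau X w)] is the sum of those [a k] with
    [k < tau X w]; integration of the nonnegative series is termwise. *)
Lemma eexpectation_tau :
  eexpectation P (fun w => f (tau X w)) =
  \sum_(0 <= k <oo) (a k)%:R%:E * tail_prob X k.+1.
Proof.
have fE w : f (tau X w) = \sum_(0 <= k <oo) (a k)%:R%:E * (\1_(unhit k) w)%:E.
  transitivity (\sum_(0 <= k <oo) (a k)%:R%:E * (k.+1%:R%:E <= tau X w)%E%:R%:E : \bar R).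
    have [->|[n ->]] := tau_natP w; first by rewrite layer_cake_pinfty.
    by rewrite f_nat layer_cake_nat.
  by apply: eq_eseriesr => k _; rewrite le_tau indicE; congr (_ * (nat_of_bool _)%:R%:E);
    apply/asboolP/idP; rewrite in_setE.
rewrite /eexpectation; under eq_integral do rewrite fE.
have mi k : measurable_fun setT
    ((fun w => (a k)%:R%:E * (\1_(unhit k) w)%:E) : T -> \bar R).
  apply: measurable_funeM; apply/measurable_EFinP.
  exact: measurable_indic.
have ge0 k w : setT w -> 0 <= (a k)%:R%:E * (\1_(unhit k) w)%:E :> \bar R.
  by rewrite mule_ge0 // lee_fin.
rewrite integral_nneseries //.
apply: eq_eseriesr => k _.
rewrite ge0_integralZl //; first by rewrite integral_indic // setIT tail_probE.
by apply/measurable_EFinP; exact: measurable_indic.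
Qed.

End Tau.

(** * Comparison of the rolls with the killed walk *)

Context (Xindep : mutually_independent X) (Xunif : forall i, uniform_die (X i)).

Definition off_die (i : nat) : set T := [set w | ~~ (1 <= X i w <= 6)%N].

Lemma roll_face i k : (1 <= k <= 6)%N -> P (X i @^-1` [set k]) = (6^-1)%:E.
Proof. by move=> /(Xunif i). Qed.

Lemma measurable_off_die i : measurable (off_die i).
Proof. exact: (measurable_roll_set i [set k | ~~ (1 <= k <= 6)%N]). Qed.

(** The six disjoint faces already carry mass [6 * 6^-1 = 1]. *)
Lemma off_die0 i : P (off_die i) = 0.
Proof.
pose F j := [set w | X i w = j.+1].
have mF j : measurable (F j) by exact: (measurable_roll_set i [set k | k = j.+1]).
have -> : off_die i = ~` (\big[setU/set0]_(j < 6) F j).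
  apply/seteqP; rewrite -bigcup_mkord; split => w /=.
    by rewrite /off_die /F /= => h [j /= j6 e]; rewrite e in h; lia.
  by move=> h; apply/negP => X6; apply: h; exists (X i w).-1; rewrite /F /=; lia.
rewrite probability_setC; last by apply: bigsetU_measurable.
rewrite measure_bigsetU //; last first.
  by move=> j k _ _ [w []]; rewrite /F /= => -> [->].
rewrite (eq_bigr (fun=> (6^-1)%:E)) => [|j _]; last first.
  by apply: (@roll_face i j.+1); have := ltn_ord j; lia.
rewrite sumEFin sumr_const card_ord -(mulr_natl 6^-1%R) mulfV ?pnatr_eq0 //.
by rewrite subee.
Qed.

Definition cylinder (k m : nat) (b : nat -> nat) : set T :=
  \bigcap_(i in [set` iota k m]) (X i @^-1` [set b i]).

Lemma measurable_cylinder k m b : measurable (cylinder k m b).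
Proof.
apply: bigcap_measurableType => i _; exact: (measurable_roll_set i [set b i]).
Qed.

Lemma cylinder_prob k m b :
  (forall i, (k <= i < k + m)%N -> (1 <= b i <= 6)%N) ->
  P (cylinder k m b) = (6 ^- m)%:E.
Proof.
move=> b6; rewrite /cylinder (@Xindep _ (fun i => [set b i])) ?iota_uniq //.
rewrite big_seq (eq_bigr (fun=> (6^-1)%:E)) => [|i]; last first.
  by rewrite mem_iota => /b6 /roll_face.
rewrite -big_seq big_const_seq count_predT size_iota.
elim: m {b6} => [|m IH] /=; first by rewrite expr0 invr1.
by rewrite IH -EFinM exprS invfM.
Qed.

Definition unhit_at (k s : nat) : set T :=
  unhit k `&` [set w | roll_sum X k w = s].

Lemma measurable_unhit_at k s : measurable (unhit_at k s).
Proof. by apply: measurableI => //; exact: (measurable_roll_sum_set k [set s]). Qed.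

(** Independence is given for product events, not for an event of the past against the next roll.
    The induction therefore moves the last roll, face by face, into the cylinder of prescribed later
    rolls, until at [k = 0] only a product event is left. *)
Lemma unhit_at_cylinder_le k m s b :
  (forall i, (k <= i < k + m)%N -> (1 <= b i <= 6)%N) ->
  P (unhit_at k s `&` cylinder k m b) <= (avoid R k s * 6 ^- m)%:E.
Proof.
have mU k' s' m' b' : measurable (unhit_at k' s' `&` cylinder k' m' b').
  by apply: measurableI; [exact: measurable_unhit_at|exact: measurable_cylinder].
elim: k s m b => [|k IH] s m b b6 /=.
  have [->|s0] := eqVneq s 0%N.
    rewrite mul1r -(cylinder_prob b6).
    apply: le_measure; rewrite ?inE //; first exact: measurable_cylinder.
  rewrite mul0r (_ : _ `&` _ = set0) ?measure0 //.
  apply/seteqP; split => w //= [[_ /=]]; rewrite roll_sum0 => /eqP.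
  by rewrite eq_sym (negbTE s0).
case: ifP => sp.
  rewrite mul0r (_ : _ `&` _ = set0) ?measure0 //.
  by apply/seteqP; split => w //= [[/unhitS[_ + /= e]]]; rewrite e sp.
(* Face [j.+1] is prescribed for roll [k]. In [F], the test [j < s] excludes a truncated difference
   [s - j.+1]. *)
pose c j i := if i == k then j.+1 else b i.
pose F j := if (j < s)%N then unhit_at k (s - j.+1) `&` cylinder k m.+1 (c j) else set0.
have mF j : measurable (F j) by rewrite /F; case: ifP.
apply: le_trans (measure_le_cover (n := 6) (mU _ _ _ _)
  (measurable_off_die k) mF (off_die0 k) _) _.
  move=> w [[/unhitS[uw _] /= sw] cw].
  have [X6|X6] := boolP (1 <= X k w <= 6)%N; [right|by left].
  rewrite roll_sumS in sw.
  exists (X k w).-1; first by lia.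
  rewrite /F ifT; last by lia.
  split; first by split => //=; lia.
  move=> i /=; rewrite /c in_cons mem_iota; case: eqVneq => [->|ik] hi.
    by rewrite /=; lia.
  by apply: cw => /=; rewrite mem_iota; lia.
apply: (@le_trans _ _ (\sum_(j < 6)
    (if (j < s)%N then avoid R k (s - j.+1) * 6 ^- m.+1 else 0)%:E)).
  apply: lee_sum => j _; rewrite /F; case: ifP => js; last by rewrite measure0.
  apply: IH => i ik; rewrite /c; case: eqVneq => [_|ne]; first by have := ltn_ord j; lia.
  by apply: b6; lia.
rewrite sumEFin lee_fin mulr_suml big_add1 big_mkord [leRHS]big_mkcond /=.
apply: ler_sum => j _; case: ifP => // _.
by rewrite exprS invfM mulrA.
Qed.

(** Almost surely the sum of [k] rolls is at most [6 * k], so the event splits over its values; each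
    piece is bounded with the empty cylinder [m = 0]. *)
Lemma unhit_le k : P (unhit k) <= (\sum_(0 <= s < 6 * k + 1) avoid R k s)%:E.
Proof.
pose B := \big[setU/set0]_(i < k) off_die i.
have mB : measurable B by apply: bigsetU_measurable => i _; exact: measurable_off_die.
have B0 : P B = 0.
  apply/eqP; rewrite eq_le measure_ge0 andbT.
  apply: le_trans (Boole_inequality P (fun i _ => measurable_off_die i)) _.
  by rewrite big1 // => i _; exact: off_die0.
apply: le_trans (measure_le_cover (n := 6 * k + 1) (measurable_unhit k) mB
  (measurable_unhit_at k) B0 _) _.
  move=> w uw; have [wB|wB] := pselect (B w); [by left|right].
  exists (roll_sum X k w); last by split.
  have X6 i : (i < k)%N -> (X i w <= 6)%N.
    move=> ik; rewrite leqNgt; apply/negP => X7; apply: wB.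
    by rewrite /B -bigcup_mkord; exists i => //=; rewrite /off_die /=; lia.
  rewrite addn1 ltnS /roll_sum; apply: leq_trans (_ : (\sum_(i < k) 6 <= _)%N).
    by apply: leq_sum => i _; exact: X6.
  by rewrite sum_nat_const card_ord; lia.
rewrite big_mkord -sumEFin; apply: lee_sum => s _.
have := @unhit_at_cylinder_le k 0 s (fun=> 0%N).
rewrite invr1 mulr1 /cylinder [iota _ _]/= set_nil bigcap_set0 setIT; apply; lia.
Qed.

Lemma tail_series_le (a : nat -> nat) : (forall k, (a k <= k.*2.+1)%N) ->
  \sum_(1000 <= k <oo) (a k)%:R%:E * tail_prob X k.+1 <= (4 * 10 ^- 9)%:E.
Proof.
move=> a2.
have t0 k : 0 <= (a k)%:R%:E * tail_prob X k.+1.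
  by rewrite mule_ge0 ?lee_fin // measure_ge0.
apply: lime_le; first by apply: is_cvg_nneseries => k _ _.
apply: nearW => N.
(* One range of [s], long enough for all [k < N], replaces the ranges [6 * k + 1]. *)
apply: (@le_trans _ _ (\sum_(1000 <= k < N)
    (k.*2.+1%:R * \sum_(0 <= s < 6 * N + 1) avoid R k s)%:E)); last first.
  by rewrite sumEFin lee_fin sum_avoid_tail.
rewrite !big_nat; apply: lee_sum => k /andP[_ kN].
rewrite EFinM; apply: lee_pmul => //; rewrite ?lee_fin ?ler_nat ?measure_ge0 //.
rewrite tail_probE; apply: le_trans (unhit_le k) _.
rewrite lee_fin [leRHS](@big_cat_nat _ _ _ (6 * k + 1)) /=; [|lia..].
by rewrite lerDl sumr_ge0 // => s _; exact: avoid_ge0.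
Qed.

End DieRolls.

(** * Truncated moments and their remainders *)

Section Truncation.
Context (d : measure_display) (T : measurableType d) (R : realType)
  (P : probability T R) (X : nat -> {RV P >-> nat})
  (Xindep : mutually_independent X) (Xunif : forall i, uniform_die (X i)).

(** Real values for the truncated sum and the remainder turn the later subtractions in [\bar R] into
    real arithmetic. The shift [k.-1] matches tail probabilities numbered from 1. *)
Lemma eexpectation_tau_trunc (a : nat -> nat) (f : \bar R -> \bar R) :
  (forall k, (0 < a k <= k.*2.+1)%N) -> f +oo = +oo ->
  (forall n, f n%:R%:E = (\sum_(0 <= k < n) a k)%N%:R%:E) ->
  exists e r : R, [/\ (0 <= e)%R, (0 <= r <= 4 * 10 ^- 9)%R,
    \sum_(1 <= k < 1001) (a k.-1)%:R%:E * tail_prob X k = e%:E &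
    eexpectation P (fun w => f (tau X w)) = (e + r)%:E].
Proof.
move=> a12 fy fn.
have t0 k : 0 <= (a k)%:R%:E * tail_prob X k.+1.
  by rewrite mule_ge0 ?lee_fin // measure_ge0.
have [a0 a2] : (forall k, 0 < a k)%N /\ (forall k, a k <= k.*2.+1)%N.
  by split => k; case/andP: (a12 k).
rewrite (eexpectation_tau X a0 fy fn) (nneseries_split 0 1000) // add0n.
have := tail_series_le Xindep Xunif a2.
set s := \sum_(1000 <= k <oo) _ => s_le.
have s0 : 0 <= s by apply: nneseries_ge0.
have sfin : s \is a fin_num by rewrite ge0_fin_numE // (le_lt_trans s_le) ?ltry.
rewrite big_add1 /=; set e := \sum_(0 <= k < 1000) _.
have e0 : 0 <= e by apply: sume_ge0.
have efin : e \is a fin_num.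
  apply/sum_fin_numP => k _ _.
  by rewrite fin_numM // tail_probE fin_num_measure //; exact: measurable_unhit.
exists (fine e), (fine s); split.
- exact: fine_ge0.
- by rewrite fine_ge0 //= -lee_fin fineK.
- by rewrite fineK.
- by rewrite EFinD !fineK.
Qed.

End Truncation.

Lemma sum_odd n : (\sum_(0 <= k < n) k.*2.+1 = n ^ 2)%N.
Proof. by elim: n => [|n IH]; [rewrite big_geq | rewrite big_nat_recr //= IH; lia]. Qed.

Theorem proposition2 (d : measure_display) (T : measurableType d)
    (R : realType) (P : probability T R) (X : nat -> {RV P >-> nat})
    (Xindep : mutually_independent X)
    (Xunif : forall i, uniform_die (X i)) :
  RE X 1000 < (10 ^- 7)%:E /\ RV X 1000 < (10 ^- 4)%:E.
Proof.
have [|||e1 [r1 [e1_ge0 /andP[r1_ge0 r1_le] E1 Etau]]] :=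
  @eexpectation_tau_trunc _ _ _ _ _ Xindep Xunif (fun=> 1%N) id => //.
  by move=> n; rewrite sum_nat_const_nat muln1 subn0.
(* The increments of the square are the odd numbers. *)
have [|||e2 [r2 [e2_ge0 /andP[r2_ge0 r2_le] E2 Etau2]]] :=
  @eexpectation_tau_trunc _ _ _ _ _ Xindep Xunif (fun k => k.*2.+1) (fun x => x ^+ 2).
- by move=> k; rewrite leqnn.
- by rewrite expe2.
- by move=> n; rewrite sum_odd -EFin_expe natrX.
have E1' : E_trunc X 1000 = e1%:E.
  by rewrite -E1; apply: eq_bigr => k _; rewrite mul1e.
have E2' : E2_trunc X 1000 = e2%:E.
  rewrite -E2 /E2_trunc !big_nat; apply: eq_bigr => k /andP[k0 _].
  by congr ((_%:R)%:E * _); lia.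
rewrite /RE /RV /evariance /V_trunc Etau Etau2 E1' E2'.
rewrite -!EFin_expe -!EFinB !lte_fin; split; first by lra.
(* The difference is [r2 - 2 * e1 * r1 - r1 ^+ 2], at most [r2] since [e1] and [r1] are
   nonnegative. *)
by nra.
Qed.
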